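(* Let $(L,\cdot)$ be a quasigroup (respectively, loop) with holomorph $H(L)$. Then $H(L)$ is a CIPQ (respectively, CIPL) if and only if all three of the following hold: 1. $AUM(L)$ is an abelian group; 2. $(\beta^{-1},\alpha,I)\in AUT(L)$ for all $\alpha,\beta\in AUM(L)$; 3. $L$ is a CIPQ (respectively, CIPL).
   Context: Mappings are written on the right of their arguments, so $x\alpha$ is the image of $x$ under $\alpha$, and $\alpha\beta$ means first $\alpha$, then $\beta$; $I$ is the identity map. A quasigroup $(L,\cdot)$ is a non-empty set with a binary operation such that for all $a,b\in L$ the equations $a\cdot x=b$ and $y\cdot a=b$ have unique solutions $x,y\in L$. A loop is a quasigroup with a (unique) two-sided identity element $e$. For $x\in L$, the right inverse $x^\rho=xJ_\rho$ and the left inverse $x^\lambda=xJ_\lambda$ are the elements with $x\cdot x^\rho=e^\rho$ and $x^\lambda\cdot x=e^\lambda$, where $e^\rho$ and $e^\lambda$ are the right and left identity elements; whenever inverses are used in a quasigroup these elements are assumed to exist (in a loop both equal $e$). $AUT(L)$ (the autotopism group) is the group, under componentwise composition, of all triples $(A,B,C)$ of bijections of $L$ with $xA\cdot yB=(x\cdot y)C$ for all $x,y\in L$. $AUM(L)$ is the automorphism group: the group of bijections $A$ of $L$ with $xA\cdot yA=(x\cdot y)A$ for all $x,y\in L$. The holomorph $H(L)$ is the set of pairs $(\alpha,x)$ with $\alpha\in AUM(L)$, $x\in L$, with operation $(\alpha,x)\circ(\beta,y)=(\alpha\beta,\ x\beta\cdot y)$. A quasigroup (loop) is a CIPQ (CIPL),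 i.e. a cross inverse property quasigroup (loop), if it satisfies one of the equivalent identities $(xy)x^\rho=y$, $x(yx^\rho)=y$, $x^\lambda(yx)=y$, $(x^\lambda y)x=y$. *)

(* Defs.v *)
From mathcomp Require Import all_boot.
Set Implicit Arguments. Unset Strict Implicit. Unset Printing Implicit Defensive.

Definition is_quasigroup (L : Type) (op : L -> L -> L) : Prop :=
  [/\ inhabited L,
      forall a b, exists! x, op a x = b
    & forall a b, exists! y, op y a = b].

Definition is_loop (L : Type) (op : L -> L -> L) : Prop :=
  is_quasigroup op /\ exists e, left_id e op /\ right_id e op.

Definition is_abelian_group (G : Type) (mul : G -> G -> G) : Prop :=
  exists (e : G) (inv : G -> G),
    [/\ associative mul, commutative mul, left_id e mul
      & left_inverse e inv mul].

(* The four equivalent cross inverse identities. In each of them e is the right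
   (resp. left) identity and J the map x |-> x^rho (resp. x |-> x^lambda); their
   existence is part of the property, since a quasigroup need not have them. *)
Definition cross_inverse_property (L : Type) (op : L -> L -> L) : Prop :=
  [\/ exists (e : L) (J : L -> L),
        [/\ right_id e op, right_inverse e J op
          & forall x y, op (op x y) (J x) = y],
      exists (e : L) (J : L -> L),
        [/\ right_id e op, right_inverse e J op
          & forall x y, op x (op y (J x)) = y],
      exists (e : L) (J : L -> L),
        [/\ left_id e op, left_inverse e J op
          & forall x y, op (J x) (op y x) = y]
    | exists (e : L) (J : L -> L),
        [/\ left_id e op, left_inverse e J op
          & forall x y, op (op (J x) y) x = y]].

Definition is_CIPQ (L : Type) (op : L -> L -> L) : Prop :=
  is_quasigroup op /\ cross_inverse_property op.

Definition is_CIPL (L : Type) (op : L -> L -> L) : Prop :=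
  is_loop op /\ cross_inverse_property op.

(* The inverse is carried as data; up to functional extensionality and proof
   irrelevance, equality of bijections is equality of the forward maps. *)
Record bijection (L : Type) := Bijection {
  bij_fun :> L -> L;
  bij_inv : L -> L;
  bij_funK : cancel bij_fun bij_inv;
  bij_invK : cancel bij_inv bij_fun
}.

Definition bij_id (L : Type) : bijection L :=
  @Bijection L id id (fun _ => erefl) (fun _ => erefl).

Definition bij_inverse (L : Type) (A : bijection L) : bijection L :=
  Bijection (bij_invK A) (bij_funK A).

(* Maps act on the right: bij_mul A B is "first A, then B". *)
Definition bij_mul (L : Type) (A B : bijection L) : bijection L :=
  @Bijection L (fun x => B (A x)) (fun x => bij_inv A (bij_inv B x))
    (can_comp (bij_funK B) (bij_funK A))
    (can_comp (bij_invK A) (bij_invK B)).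

Definition in_AUT (L : Type) (op : L -> L -> L)
    (T : bijection L * bijection L * bijection L) : Prop :=
  let: (A, B, C) := T in forall x y, op (A x) (B y) = C (op x y).

Definition is_automorphism (L : Type) (op : L -> L -> L) (A : bijection L) :
    Prop :=
  forall x y, op (A x) (A y) = A (op x y).

Record AUM (L : Type) (op : L -> L -> L) := Aum {
  aum_bij :> bijection L;
  aum_morph : is_automorphism op aum_bij
}.

Lemma is_automorphism_mul (L : Type) (op : L -> L -> L) (A B : bijection L) :
  is_automorphism op A -> is_automorphism op B ->
  is_automorphism op (bij_mul A B).
Proof. by move=> hA hB x y; rewrite /= hB hA. Qed.

Definition aum_mul (L : Type) (op : L -> L -> L) (A B : AUM op) : AUM op :=
  Aum (is_automorphism_mul (aum_morph A) (aum_morph B)).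

Definition holomorph (L : Type) (op : L -> L -> L) : Type := (AUM op * L)%type.

Definition hol_op (L : Type) (op : L -> L -> L) (p q : holomorph op) :
    holomorph op :=
  (aum_mul p.1 q.1, op (q.1 p.2) q.2).

(* Main.v *)
Require Import Defs.
From mathcomp Require Import all_boot.
From Stdlib Require Import FunctionalExtensionality ProofIrrelevance.

(** Both sides of each equivalence force the automorphism group of [L] to be
    trivial, and once it is trivial the holomorph is just a copy of [L].

    If [H(L)] has the cross inverse property, every one of the four identities
    gives, for suitable [u], [v] in [H(L)], an equation [(u q) v = q] or
    [u (q v) = q] valid for all [q = (beta, y)].  In the second component, [beta]
    only occurs through the value of [beta] at [u.2], while the right-hand side
    [y] does not depend on [beta] at all; cancelling in [L] shows that [u.2] is
    fixed by every automorphism ([fixed_of_cross_left],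
    [fixed_of_cross_right]).  As [u.2] ranges over all of [L], every automorphism
    is the identity ([AUM_trivial_of_hol_CIP]).

    Conversely, the autotopisms [(beta^-1, alpha, I)] with [alpha = I] read
    [beta^-1 x * y = x * y], so cancellation gives [beta = I]
    ([AUM_trivial_of_AUT]).

    When [AUM(L)] is trivial, the first two conditions are immediate, and the
    second projection [H(L) -> L] is an isomorphism, along which the quasigroup,
    loop and cross inverse properties are transported in both directions. *)

Set Implicit Arguments. Unset Strict Implicit. Unset Printing Implicit Defensive.

Lemma quasigroup_cancelr (L : Type) (op : L -> L -> L) :
  is_quasigroup op -> right_injective op /\ left_injective op.
Proof.
move=> [_ hl hr]; split=> a x y exy.
- by have [z [_ zu]] := hl a (op a y); rewrite -(zu x exy) -(zu y erefl).
- by have [z [_ zu]] := hr a (op y a); rewrite -(zu x exy) -(zu y erefl).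
Qed.

Section Isomorphism.

Variables (L M : Type) (op : L -> L -> L) (op' : M -> M -> M).
Variables (f : L -> M) (g : M -> L).
Hypotheses (fK : cancel f g) (gK : cancel g f).
Hypothesis fM : {morph f : x y / op x y >-> op' x y}.

Lemma quasigroup_iso : is_quasigroup op -> is_quasigroup op'.
Proof.
move=> [[x0] hl hr]; split; first by constructor; exact: f x0.
- move=> a b; have [x [ex xu]] := hl (g a) (g b).
  exists (f x); split=> [|y ey]; first by rewrite -[a]gK -fM ex gK.
  by rewrite (xu (g y)) ?gK // -[LHS]fK fM !gK ey.
- move=> a b; have [x [ex xu]] := hr (g a) (g b).
  exists (f x); split=> [|y ey]; first by rewrite -[a]gK -fM ex gK.
  by rewrite (xu (g y)) ?gK // -[LHS]fK fM !gK ey.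
Qed.

Lemma loop_iso : is_loop op -> is_loop op'.
Proof.
move=> [hq [e [el er]]]; split; first exact: quasigroup_iso.
by exists (f e); split=> x; rewrite -[x]gK -fM ?el ?er.
Qed.

Lemma cross_inverse_iso :
  cross_inverse_property op -> cross_inverse_property op'.
Proof.
have gM x y : g (op' x y) = op (g x) (g y).
  by rewrite -{1}[x]gK -{1}[y]gK -fM fK.
case=> -[e [J [h1 hJ hC]]];
  [apply: Or41 | apply: Or42 | apply: Or43 | apply: Or44];
  exists (f e), (fun x => f (J (g x))); split=> x *;
  by apply: (can_inj gK); rewrite !gM !fK ?h1 ?hJ ?hC.
Qed.

End Isomorphism.

Section Automorphisms.

Variables (L : Type) (op : L -> L -> L).

Lemma is_automorphism_id : is_automorphism op (bij_id L).
Proof. by []. Qed.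

Definition aum_id : AUM op := Aum is_automorphism_id.

(** The inverse map carried by a bijection is determined by the forward one, and
    the remaining fields are proofs. *)
Lemma aum_ext (A B : AUM op) : A =1 B -> A = B.
Proof.
case: A B => [[f f' fK f'K] hA] [[g g' gK g'K] hB] /= efg.
have {}efg : f = g by apply: functional_extensionality.
subst g; have ef' : f' = g'.
  by apply: functional_extensionality => x; rewrite -{1}[x]g'K fK.
subst g'; move: hB; rewrite (proof_irrelevance _ gK fK) (proof_irrelevance _ g'K f'K) => hB.
by rewrite (proof_irrelevance _ hB hA).
Qed.

Lemma AUM_trivial_of_AUT :
  is_quasigroup op ->
  (forall alpha beta : AUM op,
     in_AUT op (bij_inverse beta, aum_bij alpha, bij_id L)) ->
  forall (A : AUM op) x, A x = x.
Proof.
move=> /quasigroup_cancelr[_ injl] hAUT A x.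
by apply: (injl x); have /= <- := hAUT aum_id A (A x) x; rewrite bij_funK.
Qed.

(** The second component of the left side at [q = (A, y)] is
    [v.1 (A u.2 * y) * v.2], to be compared with its value at [q = (I, y)]; any
    one [y] will do, and the proof takes [y = u.2]. *)
Lemma fixed_of_cross_left (u v : holomorph op) :
  is_quasigroup op ->
  (forall q, hol_op (hol_op u q) v = q) -> forall A : AUM op, A u.2 = u.2.
Proof.
move=> /quasigroup_cancelr[_ injl] huv A.
have snd_eq (B : AUM op) : op (v.1 (op (aum_bij B u.2) u.2)) v.2 = u.2.
  by have /(congr1 snd) := huv (B, u.2).
apply: (injl u.2); apply: (can_inj (bij_funK v.1)); apply: (injl v.2).
by rewrite snd_eq (snd_eq aum_id).
Qed.

(** The second component of the left side at [q = (A, y)] is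
    [v.1 (A u.2) * (v.1 y * v.2)], to be compared with its value at
    [q = (I, y)]. *)
Lemma fixed_of_cross_right (u v : holomorph op) :
  is_quasigroup op ->
  (forall q, hol_op u (hol_op q v) = q) -> forall A : AUM op, A u.2 = u.2.
Proof.
move=> /quasigroup_cancelr[_ injl] huv A.
have snd_eq (B : AUM op) : op (v.1 (aum_bij B u.2)) (op (v.1 u.2) v.2) = u.2.
  by have /(congr1 snd) := huv (B, u.2).
apply: (can_inj (bij_funK v.1)); apply: (injl (op (v.1 u.2) v.2)).
by rewrite snd_eq (snd_eq aum_id).
Qed.

(** For the identities using left inverses the fixed elements are the second
    components of left inverses, which exhaust [L]. *)
Lemma left_inverse_snd_surj (E : holomorph op) J :
  is_quasigroup op -> left_inverse E J (@hol_op L op) ->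
  forall z, exists p, (J p).2 = z.
Proof.
move=> hq hJ z; have [_ injl] := quasigroup_cancelr hq; case: hq => _ hl _.
have [x [ezx _]] := hl z E.2; exists (aum_id, x).
by apply: (injl x); rewrite ezx; by have /(congr1 snd) := hJ (aum_id, x).
Qed.

Lemma AUM_trivial_of_hol_CIP :
  is_quasigroup op -> cross_inverse_property (@hol_op L op) ->
  forall (A : AUM op) x, A x = x.
Proof.
move=> hq hC A x; case: hC => -[E [J [_ hJ hC]]].
- exact: (fixed_of_cross_left hq (hC (aum_id, x))).
- exact: (fixed_of_cross_right hq (hC (aum_id, x))).
- have [p <-] := left_inverse_snd_surj hq hJ x.
  exact: (fixed_of_cross_right hq (hC p)).
- have [p <-] := left_inverse_snd_surj hq hJ x.
  exact: (fixed_of_cross_left hq (hC p)).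
Qed.

Section TrivialAUM.

Hypothesis AUM1 : forall (A : AUM op) x, A x = x.

Lemma AUM_all_equal (A B : AUM op) : A = B.
Proof. by apply: aum_ext => x; rewrite !AUM1. Qed.

Lemma abelian_of_trivial : is_abelian_group (@aum_mul L op).
Proof. by exists aum_id, id; split=> [A B C | A B | A | A]; apply: AUM_all_equal. Qed.

Lemma AUT_of_trivial (alpha beta : AUM op) :
  in_AUT op (bij_inverse beta, aum_bij alpha, bij_id L).
Proof. by move=> x y /=; rewrite AUM1 -{1}[x](AUM1 beta) bij_funK. Qed.

Definition hol_of (x : L) : holomorph op := (aum_id, x).

Lemma hol_ofK : cancel hol_of snd.
Proof. by []. Qed.

Lemma sndK : cancel snd hol_of.
Proof. by case=> A x; rewrite /hol_of (AUM_all_equal aum_id A). Qed.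

Lemma sndM : {morph (@snd _ _ : holomorph op -> L)
  : p q / hol_op p q >-> op p q}.
Proof. by move=> p q /=; rewrite AUM1. Qed.

Lemma hol_ofM : {morph hol_of : x y / op x y >-> hol_op x y}.
Proof. by move=> x y; rewrite -[RHS]sndK. Qed.

Lemma hol_CIPQ_iff : is_CIPQ (@hol_op L op) <-> is_CIPQ op.
Proof.
split=> -[hq hC]; split.
- exact: quasigroup_iso sndK hol_ofK sndM hq.
- exact: cross_inverse_iso sndK hol_ofK sndM hC.
- exact: quasigroup_iso hol_ofK sndK hol_ofM hq.
- exact: cross_inverse_iso hol_ofK sndK hol_ofM hC.
Qed.

Lemma hol_CIPL_iff : is_CIPL (@hol_op L op) <-> is_CIPL op.
Proof.
split=> -[hl hC]; split.
- exact: loop_iso sndK hol_ofK sndM hl.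
- exact: cross_inverse_iso sndK hol_ofK sndM hC.
- exact: loop_iso hol_ofK sndK hol_ofM hl.
- exact: cross_inverse_iso hol_ofK sndK hol_ofM hC.
Qed.

End TrivialAUM.

End Automorphisms.

Theorem corollary2p1 (L : Type) (op : L -> L -> L) :
  (is_quasigroup op ->
     (is_CIPQ (@hol_op L op) <->
      [/\ is_abelian_group (@aum_mul L op),
          forall alpha beta : AUM op,
            in_AUT op (bij_inverse beta, aum_bij alpha, bij_id L)
        & is_CIPQ op]))
  /\
  (is_loop op ->
     (is_CIPL (@hol_op L op) <->
      [/\ is_abelian_group (@aum_mul L op),
          forall alpha beta : AUM op,
            in_AUT op (bij_inverse beta, aum_bij alpha, bij_id L)
        & is_CIPL op])).
Proof.
split=> [hq | hloop].
- split=> [hH | [_ hAUT hC]].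
    have AUM1 := AUM_trivial_of_hol_CIP hq hH.2.
    split; [exact: abelian_of_trivial | exact: AUT_of_trivial |].
    exact: (hol_CIPQ_iff AUM1).1.
  exact: (hol_CIPQ_iff (AUM_trivial_of_AUT hq hAUT)).2.
- have hq := hloop.1; split=> [hH | [_ hAUT hC]].
    have AUM1 := AUM_trivial_of_hol_CIP hq hH.2.
    split; [exact: abelian_of_trivial | exact: AUT_of_trivial |].
    exact: (hol_CIPL_iff AUM1).1.
  exact: (hol_CIPL_iff (AUM_trivial_of_AUT hq hAUT)).2.
Qed.
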